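(* Let $H\in C^1(\Omega,S(m))$ with repeated eigenvalues $\lambda_i(x)$ and eigenprojections $P_i(x)$, $i=1,\dots,m$. Let $j\in\{1,2,\dots,m\}$ and assume that either $P_j$ is continuous in $\Omega$, or $\lambda_j$ is differentiable and $\operatorname{tr}P_j$ is constant in $\Omega$. Then $P_j$ is differentiable in $\Omega$ with total derivatives \[\nabla_q P_j(x) = P_j(x)\,\nabla_{A_j(x)q}H(x) + A_j(x)\,\nabla_{P_j(x)q}H(x)\] and \[\mathrm{D}_e P_j(x) = P_j(x)\,\mathrm{D}_e H(x)\,A_j(x) + A_j(x)\,\mathrm{D}_e H(x)\,P_j(x)\] for all $x\in\Omega$, all $q\in\mathbb{R}^m$ and all $e\in\mathbb{R}^n$.
   Context: $\Omega\subseteq\mathbb{R}^n$ is a domain (nonempty, open, connected) and $S(m)$ is the space of real symmetric $m\times m$ matrices. For $x\in\Omega$, $\lambda_1(x)\le\cdots\le\lambda_m(x)$ are the eigenvalues of $H(x)$ repeated according to multiplicity. The eigenprojection $P_i(x)$ is the symmetric matrix of the orthogonal projection of $\mathbb{R}^m$ onto the full eigenspace $\{\xi\in\mathbb{R}^m: H(x)\xi=\lambda_i(x)\xi\}$; thus $P_i(x)=P_k(x)$ when $\lambda_i(x)=\lambda_k(x)$, and $d_i(x):=\operatorname{tr}P_i(x)$ is the multiplicity of $\lambda_i(x)$. Define \[A_j(x) := \sum_{\substack{1\le i\le m\\ \lambda_i(x)\ne\lambda_j(x)}}\frac{P_i(x)/d_i(x)}{\lambda_j(x)-\lambda_i(x)}\in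 S(m)\] (an empty sum is zero). For a matrix-valued $F\colon\Omega\to\mathbb{R}^{m\times k}$, the directional derivative is the two-sided limit $\mathrm{D}_eF(x):=\lim_{h\to0}\frac{F(x+he)-F(x)}{h}\in\mathbb{R}^{m\times k}$, $e\in\mathbb{R}^n$. If $F$ is differentiable and $q\in\mathbb{R}^k$, $\nabla_qF(x)\in\mathbb{R}^{m\times n}$ denotes the Jacobian matrix at $x$ of the vector-valued map $y\mapsto F(y)q$, with $q$ held fixed; if the subscript depends on $x$, as in $\nabla_{\mathbf{q}(x)}F(x)$, it means $\nabla_qF(x)$ evaluated at $q=\mathbf{q}(x)$ (the subscript is not differentiated). *)

(* Defs.v *)
From HB Require Import structures.
From mathcomp Require Import all_boot all_order all_algebra.
From mathcomp Require Import all_classical all_reals all_analysis.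

Set Implicit Arguments.
Unset Strict Implicit.
Unset Printing Implicit Defensive.

Import Order.TTheory GRing.Theory Num.Theory.
Import numFieldNormedType.Exports.

Local Open Scope classical_set_scope.
Local Open Scope ring_scope.

(* Points and directions of R^n are row vectors, as in the library's jacobian;
   the vectors on which m x m matrices act are column vectors. *)

Definition is_domain (R : realType) (n : nat) (Omega : set 'rV[R]_n) : Prop :=
  [/\ Omega !=set0, open Omega & connected Omega].

(* In finite dimension, continuity of every x |-> 'D_v F x is the same as
   continuity of the total derivative x |-> 'd F x in operator norm. *)
Definition C1_on (R : realType) (n : nat) (W : normedModType R)
    (Omega : set 'rV[R]_n) (F : 'rV[R]_n -> W) : Prop :=
  (forall x, Omega x -> differentiable F x) /\
  (forall v : 'rV[R]_n, {within Omega, continuous (fun x => 'D_v F x)}).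

Definition sorted_eigenvalues (R : realType) (m : nat) (A : 'M[R]_m)
    (lam : 'I_m -> R) : Prop :=
  (forall i k : 'I_m, (i <= k)%N -> lam i <= lam k) /\
  char_poly A = \prod_(i < m) ('X - (lam i)%:P).

Definition eigenspace_col (R : realType) (m : nat) (A : 'M[R]_m) (a : R) :
    set 'cV[R]_m :=
  [set xi | A *m xi = a *: xi].

(* P is the matrix of the orthogonal projection onto the subspace E:
   P xi lies in E and xi - P xi is orthogonal to E, for every xi. *)
Definition is_orthoproj (R : realType) (m : nat) (E : set 'cV[R]_m)
    (P : 'M[R]_m) : Prop :=
  forall xi : 'cV[R]_m,
    E (P *m xi) /\ (forall eta, E eta -> eta^T *m (xi - P *m xi) = 0).

Definition Amx (R : realType) (m : nat) (lam : 'I_m -> R)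
    (P : 'I_m -> 'M[R]_m) (j : 'I_m) : 'M[R]_m :=
  \sum_(i < m | lam i != lam j)
    (lam j - lam i)^-1 *: ((\tr (P i))^-1 *: P i).

(* jacobian works on row vectors (derivative v |-> v *m J), so both its
   argument and its value are transposed to get the usual m x n Jacobian. *)
Definition nabla (R : realType) (n m k : nat) (q : 'cV[R]_k)
    (F : 'rV[R]_n -> 'M[R]_(m, k)) (x : 'rV[R]_n) : 'M[R]_(m, n) :=
  (jacobian (fun y => (F y *m q)^T) x)^T.

(* Main.v *)
(** Fix x and write P0, l0 for P_j and lambda_j at x. By the spectral theorem
    A0 = A_j(x) is the reduced resolvent: A0 (l0 - H(x)) = 1 - P0 and
    A0 P0 = 0. For y near x let Q = P_j(y), D = H(y) - H(x) and
    dl = lambda_j(y) - l0. Multiplying H(y) Q = lambda_j(y) Q by A0 gives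
      (1 - P0) Q = A0 D Q - dl A0 Q,
    while tr (P0 D Q) = dl tr (P0 Q) bounds dl by a multiple of |D|. As Q is
    idempotent, P0 - P0 Q P0 is of second order, so continuity of P_j at x yields
    Q - P0 = A0 D P0 + P0 D A0 + o(|D|). In the second alternative continuity of
    P_j comes from the same formula: (1 - P0) Q tends to 0, and when
    tr Q = tr P0 its trace is the squared Frobenius norm of P0 (1 - Q). *)

Require Import Defs.
From HB Require Import structures.
From mathcomp Require Import all_boot all_order all_algebra.
From mathcomp Require Import all_classical all_reals all_analysis.
From mathcomp Require Import ring lra.

Set Implicit Arguments.
Unset Strict Implicit.
Unset Printing Implicit Defensive.

Import Order.TTheory GRing.Theory Num.Theory.
Import numFieldNormedType.Exports.

Local Open Scope classical_set_scope.
Local Open Scope ring_scope.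

(** * Spectral theory of a symmetric matrix with split characteristic polynomial *)

(** The trace of [B *m B^T] is the sum of the squares of all entries of [B], so vanishing or
    smallness of a trace passes to the entries. *)
Lemma sqr_entry_le_tr (R : realFieldType) (m n : nat) (B : 'M[R]_(m, n)) i k :
  B i k ^+ 2 <= \tr (B *m B^T).
Proof.
have sq_ge0 a c : 0 <= B a c * B^T c a by rewrite mxE -expr2 sqr_ge0.
rewrite /mxtrace (bigD1 i)//= mxE (bigD1 k)//= [in leRHS]mxE -expr2 -addrA.
rewrite lerDl addr_ge0 ?sumr_ge0// => a _.
by rewrite mxE sumr_ge0// => c _.
Qed.

Lemma sym_nilpotent_eq0 (R : realFieldType) (m : nat) (S : 'M[R]_m.+1) k :
  S^T = S -> S ^+ k = 0 -> S = 0.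
Proof.
have sqr_eq0 (T : 'M[R]_m.+1) : T^T = T -> T ^+ 2 = 0 -> T = 0.
  move=> Tsym TT0; apply/matrixP => i l; rewrite [RHS]mxE; apply/eqP.
  rewrite -sqrf_eq0 eq_le sqr_ge0 andbT (le_trans (sqr_entry_le_tr _ _ _))//.
  by rewrite Tsym -[T *m T]/(T ^+ 2) TT0 mxtrace0.
(* As [k <= 2 ^ k], the exponent may be raised to a power of two; it is then halved repeatedly, each
   intermediate power being symmetric with square zero. *)
move=> Ssym Sk0; have : S ^+ (2 ^ k) = 0.
  by rewrite -(subnK (ltnW (ltn_expl k (ltnSn 1)))) exprD Sk0 mulr0.
elim: k {Sk0} => [|k IHk]; first by rewrite expr1.
rewrite expnSr exprM => /sqr_eq0 Sk; apply/IHk/Sk.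
elim: (2 ^ k)%N => [|l IHl]; first by rewrite expr0 trmx1.
by rewrite exprS trmx_mul IHl Ssym -[_ *m _]/(_ * _) -exprSr exprS.
Qed.

(* The product of the X - a over the distinct eigenvalues a is symmetric and
   nilpotent at A, hence 0, so that the minimal polynomial is squarefree. *)
Lemma sym_split_diagonalization (R : realFieldType) (m : nat) (A : 'M[R]_m)
    (lam : 'I_m -> R) :
    A^T = A -> char_poly A = \prod_(i < m) ('X - (lam i)%:P) ->
  exists U (d : 'rV[R]_m), [/\ U \in unitmx,
    A = invmx U *m diag_mx d *m U &
    forall a, #|[pred k | d 0 k == a]| = #|[pred i | lam i == a]|].
Proof.
case: m A lam => [|m] A lam Asym charA.
  exists 1%:M, 0; split; first exact: unitmx1.
    by rewrite thinmx0 [RHS]thinmx0.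
  by move=> a; apply: eq_card => -[].
pose s := [seq lam i | i <- enum 'I_m.+1].
have charAs : char_poly A = \prod_(a <- s) ('X - a%:P).
  by rewrite charA big_map big_enum.
pose q := \prod_(a <- undup s) ('X - a%:P).
have qA0 : horner_mx A q = 0.
  apply: (@sym_nilpotent_eq0 _ _ _ m.+1).
    move: q; apply: poly_ind => [|p c IHp]; first by rewrite rmorph0 trmx0.
    rewrite rmorphD rmorphM /= horner_mx_X horner_mx_C linearD/= tr_scalar_mx.
    by rewrite trmx_mul IHp Asym; congr (_ + _); apply: comm_mx_horner.
  (* Each of the [m.+1] factors of the characteristic polynomial divides [q], so their product
     divides [q ^+ m.+1], which therefore annihilates [A]. *)
  rewrite -rmorphXn/=; apply/mxminpoly_minP.
  apply: dvdp_trans (mxminpoly_dvd_char A) _.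
  have -> : q ^+ m.+1 = \prod_(i < m.+1) q by rewrite prodr_const card_ord.
  rewrite charA.
  elim/big_ind2 : _ => // [p1 p2 q1 q2|i _]; first exact: dvdp_mul.
  rewrite /q dvdp_XsubCl root_prod_XsubC mem_undup.
  by rewrite map_f// mem_enum.
have [U Uunit /diagonalizable_forPex[d /(simmxRL Uunit) dE]] : diagonalizable A.
  apply/diagonalizableP; exists (undup s); first exact: undup_uniq.
  exact: mxminpoly_min.
have AE : A = invmx U *m diag_mx d *m U.
  by rewrite dE !mulmxA mulVmx// mul1mx mulmxKV.
exists U, d; split=> // a.
(* Similarity preserves the characteristic polynomial; uniqueness of its factorization then
   identifies [d] and [lam] as multisets. *)
have charAd : char_poly A = \prod_(b <- [seq d 0 k | k <- enum 'I_m.+1])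
    ('X - b%:P).
  have <- : char_poly (diag_mx d) = char_poly A.
    pose W := map_mx (@polyC _) U; pose V := map_mx (@polyC _) (invmx U).
    have UK : V *m W = 1%:M.
      by rewrite -map_mxM mulVmx// map_mx1.
    rewrite AE /char_poly /char_poly_mx !map_mxM.
    have -> : 'X%:M - V *m map_mx (@polyC _) (diag_mx d) *m W =
        V *m ('X%:M - map_mx (@polyC _) (diag_mx d)) *m W.
      rewrite mulmxBr mulmxBl; congr (_ - _).
      by rewrite mul_mx_scalar -scalemxAl UK scalemx1.
    by rewrite !det_mulmx mulrAC -det_mulmx UK det1 mul1r.
  rewrite char_poly_trig ?diag_mx_is_trig// big_map big_enum.
  by apply: eq_bigr => i _; rewrite mxE eqxx.
have /permP/(_ (pred1 a)) := prod_XsubC_eq (etrans (esym charAd) charAs).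
by rewrite !count_map !cardE /enum_mem !size_filter.
Qed.

Lemma eq_mulmx_col (R : pzRingType) (m n : nat) (A B : 'M[R]_(m, n)) :
  (forall xi : 'cV[R]_n, A *m xi = B *m xi) -> A = B.
Proof. by move=> AB; apply/trmx_inj/row_matrixP => k; rewrite -!tr_col !colE AB. Qed.

(** Every [P xi] lies in [E], so orthogonality reads [P^T (1 - P) = 0]. Thus [P^T = P^T P], which is
    symmetric. *)
Lemma orthoproj_sym_idem (R : realType) (m : nat) (E : set 'cV[R]_m)
    (P : 'M[R]_m) :
  is_orthoproj E P -> P^T = P /\ P *m P = P.
Proof.
move=> projP.
have PtP : P^T *m P = P^T.
  apply/esym/subr0_eq; rewrite -[X in X - _]mulmx1 -mulmxBr.
  apply/eq_mulmx_col => xi; apply/row_matrixP => i.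
  rewrite -mulmxA row_mul -tr_col colE mul0mx row0 mulmxBl mul1mx.
  exact/(projP xi).2/(projP _).1.
have Psym : P^T = P by have /(congr1 trmx) := PtP; rewrite trmx_mul !trmxK PtP.
by rewrite -[X in X *m _]Psym PtP Psym.
Qed.

(** * The eigenprojection of a single eigenvalue *)

Section EigenProjection.
Variables (R : realType) (m : nat) (A : 'M[R]_m) (a : R) (P : 'M[R]_m).
Hypothesis Asym : A^T = A.
Hypothesis projP : is_orthoproj (eigenspace_col A a) P.

Let Psym : P^T = P := (orthoproj_sym_idem projP).1.

Lemma mul_mx_eigenproj : A *m P = a *: P.
Proof.
apply: eq_mulmx_col => xi.
by rewrite -mulmxA (projP xi).1 scalemxAl.
Qed.

Lemma mul_eigenproj_mx : P *m A = a *: P.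
Proof.
by apply: trmx_inj; rewrite trmx_mul linearZ/= Psym Asym mul_mx_eigenproj.
Qed.

(** The residual [xi - P xi] is again in the eigenspace, hence orthogonal to itself. *)
Lemma eigenproj_id (xi : 'cV[R]_m) : A *m xi = a *: xi -> P *m xi = xi.
Proof.
move=> Axi; have Exi0 : A *m (xi - P *m xi) = a *: (xi - P *m xi).
  by rewrite mulmxBr Axi mulmxA mul_mx_eigenproj scalerBr scalemxAl.
have := (projP xi).2 _ Exi0; set z := xi - P *m xi => ztz0.
apply/esym/subr0_eq/colP => i; rewrite -/z [RHS]mxE; apply/eqP.
rewrite -sqrf_eq0 eq_le sqr_ge0 andbT (le_trans (sqr_entry_le_tr _ _ _))//.
by rewrite mxtrace_mulC ztz0 mxtrace0.
Qed.

(** [U] need not be orthogonal, so [Pa] is a priori only an idempotent onto the same eigenspace,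
    giving [P Pa = Pa] and [Pa P = P]. Both commute because [P] commutes with [A], and so they
    coincide. *)
Lemma eigenproj_diagonalization U (d : 'rV[R]_m) : U \in unitmx ->
  A = invmx U *m diag_mx d *m U ->
  P = invmx U *m diag_mx (\row_k (d 0 k == a)%:R) *m U.
Proof.
move=> Uu AE; set D := diag_mx (\row_k _); set Pa := _ *m U.
have UA : U *m A = diag_mx d *m U by rewrite AE !mulmxA mulmxV// mul1mx.
have AU : A *m invmx U = invmx U *m diag_mx d by rewrite AE mulmxK.
have DD : diag_mx d *m D = a *: D.
  rewrite mulmx_diag -linearZ/=; congr diag_mx; apply/rowP => k; rewrite !mxE.
  by have [->|_] := eqVneq (d 0 k) a; rewrite ?mulr1 ?mulr0.
have PPa : P *m Pa = Pa.
  apply: eq_mulmx_col => xi; rewrite -mulmxA; apply: eigenproj_id.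
  by rewrite /Pa !mulmxA AU -(mulmxA (invmx U)) DD -!(scalemxAr, scalemxAl).
have PaP : Pa *m P = P.
  suff DUP : D *m (U *m P) = U *m P.
    by rewrite /Pa -!mulmxA DUP mulKmx.
  apply/matrixP => k l; rewrite mul_diag_mx !mxE.
  have [|dka] := eqVneq; first by rewrite mul1r.
  have /matrixP/(_ k l) : diag_mx d *m (U *m P) = a *: (U *m P).
    by rewrite mulmxA -UA -mulmxA mul_mx_eigenproj scalemxAr.
  rewrite mul_diag_mx !mxE => /eqP; rewrite -subr_eq0 -mulrBl mulf_eq0 subr_eq0.
  by rewrite (negPf dka) /= => /eqP ->; rewrite mulr0.
have UPUd : comm_mx (U *m P *m invmx U) (diag_mx d).
  rewrite /comm_mx -!mulmxA -AU [P *m (A *m _)]mulmxA mul_eigenproj_mx.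
  by rewrite [in RHS]mulmxA -UA -mulmxA [A *m _]mulmxA mul_mx_eigenproj.
have UPU : comm_mx (U *m P *m invmx U) D.
  move: (U *m P *m invmx U) UPUd => M Md.
  (* Entry [(k, l)] of [M] vanishes unless [d 0 k = d 0 l], and then the two indicators agree. *)
  apply/matrixP => k l; have /matrixP/(_ k l) := Md.
  rewrite !mul_mx_diag !mul_diag_mx !mxE => /eqP.
  rewrite mulrC -subr_eq0 -mulrBl mulf_eq0 subr_eq0.
  move=> /orP[/eqP ->|/eqP ->]; last by rewrite mulr0 mul0r.
  by rewrite mulrC.
have PE : P = invmx U *m (U *m P *m invmx U) *m U.
  by rewrite !mulmxA mulVmx// mul1mx mulmxKV.
rewrite -PaP -[RHS]PPa {}PE /Pa; move: (U *m P *m invmx U) UPU => M MD.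
by rewrite !mulmxA !mulmxK// -(mulmxA _ D) -MD !mulmxA.
Qed.

End EigenProjection.

(** * Multiplicities, resolution of the identity and reduced resolvent *)

Section SymmetricSpectrum.
Variables (R : realType) (m : nat) (A : 'M[R]_m) (lam : 'I_m -> R).
Variable P : 'I_m -> 'M[R]_m.
Hypothesis Asym : A^T = A.
Hypothesis charA : char_poly A = \prod_(i < m) ('X - (lam i)%:P).
Hypothesis projP : forall i, is_orthoproj (eigenspace_col A (lam i)) (P i).

(** In a diagonalizing basis the projection is a 0-1 diagonal matrix whose ones mark the occurrences
    of [lam i]. *)
Lemma tr_eigenproj i : \tr (P i) = #|[pred k | lam k == lam i]|%:R.
Proof.
have [U [d [Uu AE cntE]]] := sym_split_diagonalization Asym charA.
rewrite (eigenproj_diagonalization Asym (projP i) Uu AE) mxtrace_mulC mulmxA.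
rewrite mulmxV// mul1mx mxtrace_diag -cntE -sum1_card natr_sum [RHS]big_mkcond.
by apply: eq_bigr => k _; rewrite mxE inE; case: eqP.
Qed.

Lemma tr_eigenproj_ge1 i : 1 <= \tr (P i).
Proof. by rewrite tr_eigenproj ler1n; apply/card_gt0P; exists i; rewrite inE. Qed.

Lemma tr_eigenproj_neq0 i : \tr (P i) != 0.
Proof. by rewrite gt_eqF// (lt_le_trans ltr01)// tr_eigenproj_ge1. Qed.

Lemma eq_eigenproj i k : lam i = lam k -> P i = P k.
Proof.
have [U [d [Uu AE _]]] := sym_split_diagonalization Asym charA.
rewrite (eigenproj_diagonalization Asym (projP i) Uu AE).
by rewrite (eigenproj_diagonalization Asym (projP k) Uu AE) => ->.
Qed.

(** Evaluate [P i *m A *m P k] from either side. *)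
Lemma eigenproj_orthogonal i k : lam i != lam k -> P i *m P k = 0.
Proof.
move=> ik; have : (lam i - lam k) *: (P i *m P k) = 0.
  rewrite scalerBl scalemxAl -(mul_eigenproj_mx Asym (projP i)).
  by rewrite scalemxAr -(mul_mx_eigenproj (projP k)) mulmxA subrr.
by move/eqP; rewrite scaler_eq0 subr_eq0 (negPf ik) => /eqP.
Qed.

(* Each distinct projection P i occurs tr (P i) times in the sum. *)
Lemma sum_eigenproj : \sum_i (\tr (P i))^-1 *: P i = 1%:M.
Proof.
have [U [d [Uu AE cntE]]] := sym_split_diagonalization Asym charA.
have -> : \sum_i (\tr (P i))^-1 *: P i = invmx U *m
    (\sum_i (\tr (P i))^-1 *: diag_mx (\row_k (d 0 k == lam i)%:R)) *m U.
  rewrite mulmx_sumr mulmx_suml; apply: eq_bigr => i _.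
  rewrite -scalemxAr -scalemxAl.
  by rewrite -(eigenproj_diagonalization Asym (projP i) Uu AE).
suff -> : \sum_i (\tr (P i))^-1 *: diag_mx (\row_k (d 0 k == lam i)%:R)
    = 1%:M :> 'M[R]_m.
  by rewrite mulmx1 mulVmx.
apply/matrixP => k l; rewrite summxE [RHS]mxE.
have [->|kl] := eqVneq k l; last first.
  by rewrite big1// => i _; rewrite !mxE (negPf kl) mulr0n mulr0.
under eq_bigr => i _ do rewrite !mxE eqxx mulr1n tr_eigenproj.
(* At diagonal position [l] exactly [c] indices contribute, each [c^-1]; [c] is positive since [l]
   itself is counted on the [d] side. *)
set c := #|[pred i | lam i == d 0 l]|.
have c_neq0 : c%:R != 0 :> R.
  rewrite pnatr_eq0 -lt0n /c -cntE; apply/card_gt0P; exists l.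
  by rewrite inE.
transitivity (\sum_(i | lam i == d 0 l) (c%:R^-1 : R)).
  rewrite [RHS]big_mkcond; apply: eq_bigr => i _; rewrite eq_sym.
  by case: eqP => [->|]; rewrite ?mulr0 ?mulr1.
by rewrite sumr_const -[X in _ *+ X]/c -[LHS]mulr_natr mulVf.
Qed.

Lemma Amx_sym j : (Amx lam P j)^T = Amx lam P j.
Proof.
rewrite /Amx linear_sum; apply: eq_bigr => i _.
by do 2![rewrite linearZ; congr (_ *: _)]; rewrite /= (orthoproj_sym_idem (projP i)).1.
Qed.

Lemma mul_Amx_eigenproj j : Amx lam P j *m P j = 0.
Proof.
rewrite /Amx mulmx_suml big1// => i ij.
by rewrite -!scalemxAl eigenproj_orthogonal// !scaler0.
Qed.

(** Termwise, [lam i / (lam j - lam i) = lam j / (lam j - lam i) - 1]; the terms coming from [- 1]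
    add up to [- (1 - P j)] by the resolution of the identity. *)
Lemma mul_Amx_mx j : Amx lam P j *m A = lam j *: Amx lam P j - (1%:M - P j).
Proof.
rewrite -sum_eigenproj (bigID (fun i => lam i == lam j))/=.
have -> : \sum_(i | lam i == lam j) (\tr (P i))^-1 *: P i = P j.
  rewrite (eq_bigr (fun=> (\tr (P j))^-1 *: P j)); last first.
    by move=> i /eqP/eq_eigenproj ->.
  rewrite sumr_const -scaler_nat scalerA.
  by rewrite -[X in X%:R * _]/(#|_|) -tr_eigenproj mulfV ?tr_eigenproj_neq0// scale1r.
rewrite [P j + _]addrC addrK /Amx mulmx_suml scaler_sumr -sumrB; apply: eq_bigr => i ij.
rewrite -!scalemxAl (mul_eigenproj_mx Asym (projP i)) !scalerA -scalerBl.
congr (_ *: _); have : lam j - lam i != 0 by rewrite subr_eq0 eq_sym.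
have := tr_eigenproj_neq0 i.
by move=> ? ?; field; apply/andP.
Qed.

End SymmetricSpectrum.

(** * Quantitative perturbation of projections *)

Section MatrixNorm.
Variable R : realType.

Lemma entry_le_mx_norm (m n : nat) (A : 'M[R]_(m, n)) i k : `|A i k| <= `|A|.
Proof.
rewrite [leRHS]/Num.norm/= mx_normrE.
exact: (le_bigmax _ (fun ik => `|A ik.1 ik.2|) (i, k)).
Qed.

Lemma mx_norm_le (m n : nat) (A : 'M[R]_(m, n)) (c : R) :
  0 <= c -> (forall i k, `|A i k| <= c) -> `|A| <= c.
Proof.
move=> c0 Ac; rewrite [leLHS]/Num.norm/= mx_normrE.
by apply/bigmax_leP; split=> // -[i k].
Qed.

(* The factor m makes the maximum norm submultiplicative. *)
Definition scaled_mx_norm (m : nat) (A : 'M[R]_m) : R := m%:R * `|A|.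
Local Notation nu := scaled_mx_norm.

Lemma scaled_mx_norm_ge0 m (A : 'M[R]_m) : 0 <= nu A.
Proof. by rewrite mulr_ge0. Qed.

Lemma mx_norm_le_scaled m (A : 'M[R]_m) : (0 < m)%N -> `|A| <= nu A.
Proof. by move=> m0; rewrite ler_peMl// ler1n. Qed.

Lemma scaled_mx_normD m (A B : 'M[R]_m) a b :
  nu A <= a -> nu B <= b -> nu (A + B) <= a + b.
Proof.
move=> Aa Bb; apply: le_trans (lerD Aa Bb).
by rewrite -mulrDr ler_wpM2l// ler_normD.
Qed.

Lemma scaled_mx_normN m (A : 'M[R]_m) : nu (- A) = nu A.
Proof. by rewrite /scaled_mx_norm normrN. Qed.

Lemma scaled_mx_normB m (A B : 'M[R]_m) a b :
  nu A <= a -> nu B <= b -> nu (A - B) <= a + b.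
Proof. by move=> Aa Bb; rewrite scaled_mx_normD// scaled_mx_normN. Qed.

Lemma scaled_mx_normZ m (c : R) (A : 'M[R]_m) k a :
  `|c| <= k -> nu A <= a -> nu (c *: A) <= k * a.
Proof.
move=> ck Aa; rewrite /scaled_mx_norm normrZ mulrCA ler_pM// mulr_ge0//.
Qed.

Lemma scaled_mx_normM m (A B : 'M[R]_m) a b :
  nu A <= a -> nu B <= b -> nu (A *m B) <= a * b.
Proof.
move=> Aa Bb; apply: le_trans (ler_pM _ _ Aa Bb); try exact: scaled_mx_norm_ge0.
rewrite /scaled_mx_norm -mulrA ler_wpM2l// mx_norm_le ?mulr_ge0// => i k.
rewrite mxE (le_trans (ler_norm_sum _ _ _))//.
apply: (@le_trans _ _ (\sum_(l < m) `|A| * `|B|)).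
  by apply: ler_sum => l _; rewrite normrM ler_pM// entry_le_mx_norm.
by rewrite sumr_const card_ord -[leLHS]mulr_natl mulrCA.
Qed.

Lemma norm_mxtrace_le m (A : 'M[R]_m) a : nu A <= a -> `|\tr A| <= a.
Proof.
apply: le_trans; rewrite (le_trans (ler_norm_sum _ _ _))//.
rewrite /scaled_mx_norm mulr_natl -[X in _ *+ X]card_ord -sumr_const.
by apply: ler_sum => l _; rewrite entry_le_mx_norm.
Qed.

Lemma mx_addE m n (A B : 'M[R]_(m, n)) i k : (A + B) i k = A i k + B i k.
Proof. by rewrite mxE. Qed.

Lemma mx_oppE m n (A : 'M[R]_(m, n)) i k : (- A) i k = - A i k.
Proof. by rewrite mxE. Qed.

Lemma mx_scaleE m n c (A : 'M[R]_(m, n)) i k : (c *: A) i k = c * A i k.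
Proof. by rewrite mxE. Qed.

(* With S = P0 Q P0 and T = P0 - S, idempotency gives T = (S - S^2) + T^2, where
   S - S^2 = P0 (Q - P0) (Q - P0 Q) P0 is of second order; so T is negligible. *)
Lemma projection_expansion (m : nat) (P0 A0 : 'M[R]_m) :
    P0 *m P0 = P0 -> A0 *m P0 = 0 -> P0 *m A0 = 0 -> 1 <= \tr P0 ->
  exists K r : R, [/\ 0 <= K, 0 < r &
    forall (Q D : 'M[R]_m) (dl : R),
      Q *m Q = Q ->
      Q - P0 *m Q = A0 *m D *m Q - dl *: (A0 *m Q) ->
      Q - Q *m P0 = Q *m D *m A0 - dl *: (Q *m A0) ->
      \tr (P0 *m D *m Q) = dl * \tr (P0 *m Q) ->
      nu (Q - P0) <= r ->
      nu (Q - P0 - (A0 *m D *m P0 + P0 *m D *m A0))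
        <= K * nu D * nu (Q - P0)].
Proof.
move=> P0P0 A0P0 P0A0 trP0.
have nu_bound (A : 'M[R]_m) : exists2 c, 0 <= c & nu A <= c.
  by exists (nu A); rewrite ?scaled_mx_norm_ge0.
have [p p0 nP] := nu_bound P0; have [a a0 nA] := nu_bound A0.
(* [k1 * nu D] will bound [dl] and [k2 * nu D] will bound [Q - P0 *m Q]. The five summands of [K]
   match, in order, the five remainder terms estimated at the end. *)
pose k1 := 2 * (p * (p + 1)); pose k2 := a * (p + 1) + k1 * (a * (p + 1)).
have k10 : 0 <= k1 by rewrite /k1 !mulr_ge0// addr_ge0.
have k20 : 0 <= k2 by rewrite /k2 addr_ge0// !mulr_ge0// addr_ge0.
pose K := a + k1 * a + p * a + k1 * (p * a) + 2 * (p * k2 * p).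
have K0 : 0 <= K by rewrite /K; clearbody k1 k2; rewrite !addr_ge0// !mulr_ge0.
(* This radius yields [e <= 1] (so [nu Q <= p + 1]), [p * e <= 1/2] (so [\tr (P0 *m Q)] stays at
   least [1/2]) and [p * e * p <= 1/2] (to absorb [T *m T]). *)
exists K, (2 * (1 + p + p * p))^-1.
have s0 : 0 < 1 + p + p * p by rewrite ltr_wpDr ?mulr_ge0// ltr_wpDr.
split=> //; first by rewrite invr_gt0 mulr_gt0.
move=> Q D dl QQ hX hY htr; set E := Q - P0; set e := nu E; set u := nu D.
have nE : nu E <= e by [].
have nD : nu D <= u by [].
have e0 : 0 <= e by exact: scaled_mx_norm_ge0.
have u0 : 0 <= u by exact: scaled_mx_norm_ge0.
rewrite -[_^-1]mul1r ler_pdivlMr ?mulr_gt0// => er.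
have e1 : e <= 1 by nra.
have pe : p * e <= 2^-1 by nra.
have pep : p * e * p <= 2^-1 by nra.
have QE : Q = P0 + E by rewrite /E addrC subrK.
clearbody E.
have nQ : nu Q <= p + 1 by rewrite QE (le_trans (scaled_mx_normD nP nE))// lerD2l.
have ndl : `|dl| <= k1 * u.
  have trPQ : 2^-1 <= \tr (P0 *m Q).
    have := norm_mxtrace_le (scaled_mx_normM nP nE).
    rewrite QE mulmxDr P0P0 linearD/= => /le_trans/(_ pe).
    by rewrite ler_norml => /andP[? ?]; lra.
  have := norm_mxtrace_le (scaled_mx_normM (scaled_mx_normM nP nD) nQ).
  rewrite htr normrM [`|\tr _|]ger0_norm; last lra.
  have := normr_ge0 dl; rewrite /k1; nra.
have [X XE] : exists X, X = Q - P0 *m Q by eexists.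
have nX : nu X <= k2 * u.
  rewrite XE hX.
  apply: le_trans (scaled_mx_normB (scaled_mx_normM (scaled_mx_normM nA nD) nQ)
    (scaled_mx_normZ ndl (scaled_mx_normM nA nQ))) _.
  by rewrite /k2; lra.
have [T TD] : exists T, T = P0 - P0 *m Q *m P0 by eexists.
have TE : T = - (P0 *m E *m P0).
  by rewrite TD QE mulmxDr mulmxDl P0P0 P0P0 opprD addNKr.
have nT : nu T <= p * e * p.
  rewrite TE scaled_mx_normN.
  exact: scaled_mx_normM (scaled_mx_normM nP nE) nP.
have TT : T = P0 *m E *m X *m P0 + T *m T.
  have P0X : P0 *m X = 0 by rewrite XE mulmxBr mulmxA P0P0 subrr.
  have -> : P0 *m E *m X = P0 *m Q *m X.
    by rewrite QE mulmxDr P0P0 mulmxDl P0X add0r.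
  rewrite TD XE !(mulmxBr, mulmxBl, mulmxA) P0P0 -!(mulmxA _ P0 P0) P0P0.
  rewrite -(mulmxA _ Q Q) QQ.
  by apply/matrixP => i k; rewrite !(mx_addE, mx_oppE); ring.
(* The quadratic term is at most half of [nu T]; moving it to the left doubles the constant. *)
have nT' : nu T <= 2 * (p * k2 * p) * u * e.
  have nT2 : nu T <= p * e * (k2 * u) * p + nu T * (p * e * p).
    rewrite [in leLHS]TT; apply: scaled_mx_normD.
      apply: scaled_mx_normM => //; apply: scaled_mx_normM => //.
      exact: scaled_mx_normM.
    exact: scaled_mx_normM.
  have := scaled_mx_norm_ge0 T; nra.
(* Exactly, [E = X + P0 (Q - Q P0) - T]. Substituting [Q = P0 + E] in the perturbation identities
   isolates the first-order terms, and [A0 P0 = P0 A0 = 0] removes the zeroth-order factors of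
   [dl]. *)
have -> : E - (A0 *m D *m P0 + P0 *m D *m A0) =
    A0 *m D *m E - dl *: (A0 *m E) + P0 *m E *m D *m A0 - dl *: (P0 *m E *m A0) - T.
  have EE : E = X + P0 *m (Q - Q *m P0) - T.
    have -> : E = Q - P0 by rewrite QE [RHS]addrAC subrr add0r.
    rewrite XE TD mulmxBr mulmxA.
    by apply/matrixP => i k; rewrite !(mx_addE, mx_oppE); ring.
  have XA : X = A0 *m D *m P0 + A0 *m D *m E - dl *: (A0 *m E).
    by rewrite XE hX QE !mulmxDr A0P0 add0r.
  have YA : P0 *m (Q - Q *m P0) =
      P0 *m D *m A0 + P0 *m E *m D *m A0 - dl *: (P0 *m E *m A0).
    rewrite hY mulmxBr -scalemxAr !mulmxA QE !(mulmxDr, mulmxDl) P0P0 P0A0 add0r.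
    by [].
  rewrite [in LHS]EE XA YA.
  by apply/matrixP => i k; rewrite !(mx_addE, mx_oppE, mx_scaleE); ring.
apply: le_trans (_ : a * u * e + k1 * u * (a * e) + p * e * u * a + k1 * u * (p * e * a)
   + 2 * (p * k2 * p) * u * e <= _); last by rewrite /K; lra.
apply: scaled_mx_normB => //; apply: scaled_mx_normB; last first.
  apply: scaled_mx_normZ => //; apply: scaled_mx_normM => //.
  exact: scaled_mx_normM.
apply: scaled_mx_normD; last first.
  by do 2![apply: scaled_mx_normM => //]; exact: scaled_mx_normM.
apply: scaled_mx_normB.
  by apply: scaled_mx_normM => //; exact: scaled_mx_normM.
by apply: scaled_mx_normZ => //; exact: scaled_mx_normM.
Qed.

End MatrixNorm.

(** * Differentials *)

(** Expanding in the elementary matrices shows that [f] is bounded. *)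
Lemma mx_linear_continuous (R : realType) (m n : nat) (W : normedModType R)
    (f : {linear 'M[R]_(m, n) -> W}) : continuous f.
Proof.
apply: bounded_linear_continuous; apply/bounded_funP => r.
exists (r * \sum_i \sum_k `|f (delta_mx i k)|) => X Xr.
rewrite [X]matrix_sum_delta linear_sum mulr_sumr.
rewrite (le_trans (ler_norm_sum _ _ _))// ler_sum// => i _.
rewrite linear_sum mulr_sumr (le_trans (ler_norm_sum _ _ _))// ler_sum// => k _.
by rewrite linearZ/= normrZ ler_wpM2r// (le_trans _ Xr)// entry_le_mx_norm.
Qed.

Section LinearImage.
Variables (R : realType) (V W : normedModType R) (m n : nat).
Variables (L : {linear 'M[R]_(m, n) -> W}) (F : V -> 'M[R]_(m, n)) (x : V).
Hypothesis dF : differentiable F x.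

Lemma differentiable_mx_linear : differentiable (L \o F) x.
Proof.
by apply: differentiable_comp => //; exact/linear_differentiable/mx_linear_continuous.
Qed.

Lemma diff_mx_linear : 'd (L \o F) x = L \o 'd F x :> (V -> W).
Proof.
rewrite diff_comp//; last exact/linear_differentiable/mx_linear_continuous.
by rewrite diff_lin//; exact: mx_linear_continuous.
Qed.

End LinearImage.

(** The map [y |-> (F y *m q)^T] is [F] followed by a fixed linear map, so the chain rule turns
    [nabla] into the differential of [F]. *)
Lemma nablaE (R : realType) (n m k : nat) (q : 'cV[R]_k)
    (F : 'rV[R]_n -> 'M[R]_(m, k)) (x v : 'rV[R]_n) :
  differentiable F x -> nabla q F x *m v^T = 'd F x v *m q.
Proof.
move=> dF; apply: trmx_inj.
rewrite trmx_mul !trmxK mul_rV_lin1 trmx_mul.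
pose L := trmx \o mulmxr q : {linear 'M[R]_(m, k) -> 'rV[R]_m}.
rewrite -[fun y => _]/(L \o F) diff_mx_linear//.
exact: trmx_mul.
Qed.

Lemma differentiable_lipschitz_near (R : realType) (V W : normedModType R)
    (f : V -> W) x : differentiable f x ->
  exists2 C, 0 < C & \forall y \near x, `|f y - f x| <= C * `|y - x|.
Proof.
move=> df; have [k k0 kP] := linear_lipschitz (diff_continuous df).
(* [k] bounds the differential, and the little-o remainder taken with constant 1 adds the rest. *)
exists (k + 1); first by rewrite addr_gt0.
have /eqaddoP/(_ 1 ltr01) := diff_locally df.
rewrite [in X in _ -> X](near_shift 0) subr0; apply: filterS => h /=.
rewrite mul1r addrK -[(_ - _) h]/(f (h + x) - (f x + 'd f x h)) opprD addrA => fh.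
rewrite -[f _ - f x](subrK ('d f x h)) mulrDl mul1r addrC.
by rewrite (le_trans (ler_normD _ _))// lerD.
Qed.

(** Maps whose increments at [x] differ by [o(|y - x|)] share their differential; [g] will be a
    linear image of [H]. *)
Lemma diff_littleo (R : realType) (V W : normedModType R) (f g : V -> W) x :
    differentiable g x ->
    (forall e, 0 < e ->
      \forall y \near x, `|f y - f x - (g y - g x)| <= e * `|y - x|) ->
  differentiable f x /\ 'd f x = 'd g x :> (V -> W).
Proof.
move=> dg fg.
have df : f \o shift x = cst (f x) + 'd g x +o_ 0 id.
  apply/eqaddoP => e e0; have e2 : 0 < e / 2 by rewrite divr_gt0.
  have /eqaddoP/(_ _ e2) := diff_locally dg.
  have := fg _ e2; rewrite (near_shift 0) subr0.
  apply: filterS2 => h /=; rewrite addrK => fgh.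
  rewrite -[(_ - _) h]/(g (h + x) - (g x + 'd g x h)) => gh.
  rewrite -[(_ - _) h]/(f (h + x) - (f x + 'd g x h)).
  rewrite [e]splitr mulrDl; apply: le_trans (lerD fgh gh).
  apply: le_trans (ler_normD _ _); rewrite le_eqVlt; apply/orP; left; apply/eqP.
  by congr (`| _ |); rewrite opprD (opprD (g x)) opprB !addrA subrK addrK.
have dfE := diff_unique (diff_continuous dg) df.
by split=> //; apply/diff_locallyP; rewrite dfE; split=> //; exact: diff_continuous.
Qed.

(** * Identities and bounds relating eigenprojections of two symmetric matrices *)

Section Perturbation.
Variables (R : realType) (m : nat) (H0 H1 P0 P1 A0 : 'M[R]_m) (l0 l1 : R).
Hypothesis A0H0 : A0 *m H0 = l0 *: A0 - (1%:M - P0).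
Hypothesis proj0 : is_orthoproj (eigenspace_col H0 l0) P0.
Hypothesis proj1 : is_orthoproj (eigenspace_col H1 l1) P1.
Hypotheses (H0_sym : H0^T = H0) (H1_sym : H1^T = H1) (A0_sym : A0^T = A0).

(** Expand [A0 (H1 - H0) P1] with [H1 P1 = l1 P1] and [A0H0]. *)
Lemma resolvent_perturbation_left :
  P1 - P0 *m P1 = A0 *m (H1 - H0) *m P1 - (l1 - l0) *: (A0 *m P1).
Proof.
rewrite mulmxBr mulmxBl -mulmxA (mul_mx_eigenproj proj1) A0H0.
rewrite !mulmxBl mul1mx -scalemxAr -scalemxAl scalerBl.
by apply/matrixP => i k; rewrite !(mx_addE, mx_oppE, mx_scaleE); ring.
Qed.

(** The transpose of the left version, all matrices involved being symmetric. *)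
Lemma resolvent_perturbation_right :
  P1 - P1 *m P0 = P1 *m (H1 - H0) *m A0 - (l1 - l0) *: (P1 *m A0).
Proof.
apply: trmx_inj; have [P0s _] := orthoproj_sym_idem proj0.
have [P1s _] := orthoproj_sym_idem proj1.
rewrite linearB [RHS]linearB/= linearZ/= !trmx_mul [(H1 - H0)^T]linearB/=.
rewrite P0s P1s A0_sym H0_sym H1_sym.
by rewrite resolvent_perturbation_left mulmxA.
Qed.

(** This controls the eigenvalue increment when only continuity of the projection is known. *)
Lemma trace_perturbation :
  \tr (P0 *m (H1 - H0) *m P1) = (l1 - l0) * \tr (P0 *m P1).
Proof.
rewrite mulmxBr mulmxBl -mulmxA (mul_mx_eigenproj proj1).
rewrite (mul_eigenproj_mx H0_sym proj0) -scalemxAr -scalemxAl -scalerBl.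
by rewrite mxtraceZ.
Qed.

(* tr (P1 - P0 P1) = tr (P0 (1 - P1) P0) is the sum of the squares of the entries
   of P0 - P0 P1. *)
Lemma sqr_entry_projB_le : \tr P1 = \tr P0 -> forall i k,
  (P0 - P0 *m P1) i k ^+ 2 <= \tr (P1 - P0 *m P1).
Proof.
move=> trP i k; have [P0s P0P0] := orthoproj_sym_idem proj0.
have [P1s P1P1] := orthoproj_sym_idem proj1.
apply: le_trans (sqr_entry_le_tr _ i k) _.
rewrite linearB/= trmx_mul P0s P1s mulmxBl !mulmxBr P0P0 !mulmxA.
rewrite -[P0 *m P1 *m P1]mulmxA P1P1 subrr subr0 !linearB/= trP.
by rewrite [X in _ - X]mxtrace_mulC mulmxA P0P0.
Qed.

(** Squared entries are at most [\tr (P1 *m P1^T) = \tr P1], and a trace of at least 1 dominates its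
    own square root. *)
Lemma scaled_norm_proj_le : 1 <= \tr P1 ->
  scaled_mx_norm P1 <= m%:R * \tr P1.
Proof.
move=> tr1; have [P1s P1P1] := orthoproj_sym_idem proj1.
rewrite /scaled_mx_norm ler_wpM2l// mx_norm_le ?(le_trans ler01)// => i k.
have := sqr_entry_le_tr P1 i k; rewrite P1s P1P1 -real_normK ?num_real//.
have := normr_ge0 (P1 i k); nra.
Qed.

End Perturbation.

(** * Continuity and differential of an eigenprojection at a point *)

Section EigenprojectionDifferential.
Variables (R : realType) (V : normedModType R) (m : nat).
Variables (H Q : V -> 'M[R]_m) (lam : V -> R) (A0 : 'M[R]_m) (x : V).
Hypothesis A0H : A0 *m H x = lam x *: A0 - (1%:M - Q x).
Hypothesis A0_sym : A0^T = A0.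
Hypothesis A0Q : A0 *m Q x = 0.
Hypothesis trQ : 1 <= \tr (Q x).
Hypothesis Hproj : \forall y \near x, (H y)^T = H y /\
  is_orthoproj (eigenspace_col (H y) (lam y)) (Q y).

Let m_gt0 : (0 < m)%N.
Proof. by case: m Q trQ => // Q'; rewrite /mxtrace big_ord0 ler10. Qed.

Let mR_gt0 : 0 < m%:R :> R. Proof. by rewrite ltr0n. Qed.

Lemma cvg_eigenprojection : {for x, continuous H} -> {for x, continuous lam} ->
  (\forall y \near x, \tr (Q y) = \tr (Q x)) -> {for x, continuous Q}.
Proof.
move=> Hc lc trc; have [Hxs projx] := nbhs_singleton Hproj.
pose d := \tr (Q x).
pose nu := @scaled_mx_norm R m.
(* The bound on [Q y - Q x *m Q y] given by the left perturbation identity, with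
   [nu (Q y) <= m%:R * d] from the constant trace. *)
pose h y := (nu A0 * (m%:R * `|H y - H x|) + `|lam y - lam x| * nu A0) * (m%:R * d).
have h0 : h y @[y --> x] --> 0.
  have -> : 0 = (nu A0 * (m%:R * `|H x - H x|) + `|lam x - lam x| * nu A0) * (m%:R * d).
    by rewrite !subrr !normr0 !(mulr0, mul0r) addr0 mul0r.
  apply: cvgM; last exact: cvg_cst.
  apply: cvgD; apply: cvgM; try exact: cvg_cst.
    apply: cvgM; first exact: cvg_cst.
    by apply: cvg_norm; apply: cvgB => //; exact: cvg_cst.
  by apply: cvg_norm; apply: cvgB => //; exact: cvg_cst.
have hX : \forall y \near x, nu (Q y - Q x *m Q y) <= h y.
  near=> y.
  have [Hys projy] : (H y)^T = H y /\ is_orthoproj (eigenspace_col (H y) (lam y)) (Q y).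
    by near: y.
  have trQy : \tr (Q y) = d by near: y.
  rewrite (resolvent_perturbation_left A0H projy).
  have nQ : nu (Q y) <= m%:R * d by rewrite -trQy (scaled_norm_proj_le projy)// trQy.
  apply: le_trans (scaled_mx_normB (scaled_mx_normM
    (scaled_mx_normM (lexx _) (lexx _)) nQ)
    (scaled_mx_normZ (lexx _) (scaled_mx_normM (lexx _) nQ))) _.
  by rewrite /h /nu /scaled_mx_norm; lra.
(* [e / 2] serves for [Q y - Q x *m Q y] itself, its square for the squared entries of
   [Q x - Q x *m Q y]. *)
apply/cvgrPdistC_le => e e0; pose z := Num.min (e / 2) ((e / 2) ^+ 2).
have z0 : 0 < z by rewrite /z lt_min exprn_gt0 divr_gt0.
have hz : \forall y \near x, `|h y| <= z by exact: (cvgr0_norm_le _ h0).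
near=> y.
have [Hys projy] : (H y)^T = H y /\ is_orthoproj (eigenspace_col (H y) (lam y)) (Q y).
  by near: y.
have trQy : \tr (Q y) = d by near: y.
have : nu (Q y - Q x *m Q y) <= z.
  apply: (@le_trans _ _ (h y)); first by near: y.
  by apply: le_trans (ler_norm _) _; near: y.
rewrite /z le_min => /andP[X1 X2].
rewrite -[Q y - Q x](subrKA (Q x *m Q y)) [e]splitr.
rewrite (le_trans (ler_normD _ _))// lerD//.
  exact: le_trans (mx_norm_le_scaled _ m_gt0) X1.
rewrite -normrN opprB mx_norm_le ?divr_ge0 ?ltW// => i k.
rewrite -ler_sqr ?nnegrE ?divr_ge0 ?(ltW e0)// real_normK ?num_real//.
apply: le_trans (sqr_entry_projB_le projx projy trQy i k) _.
by apply: le_trans (ler_norm _) _; exact: norm_mxtrace_le.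
Unshelve. all: by end_near. Qed.

(** Compare [Q] with [L \o H]: the increments differ by at most
    [K * nu (H y - H x) * nu (Q y - Q x)], where the first norm is [O(|y - x|)] and the second tends
    to 0. *)
Lemma diff_eigenprojection : differentiable H x -> {for x, continuous Q} ->
  differentiable Q x /\ 'd Q x =
    (fun v => Q x *m 'd H x v *m A0 + A0 *m 'd H x v *m Q x) :> (V -> 'M[R]_m).
Proof.
move=> dHx Qc; have [Hxs projx] := nbhs_singleton Hproj.
have [Qxs QxQx] := orthoproj_sym_idem projx.
pose L : {linear 'M[R]_m -> 'M[R]_m} :=
  (mulmxr A0 \o mulmx (Q x)) \+ (mulmxr (Q x) \o mulmx A0).
have QA0 : Q x *m A0 = 0.
  by apply: trmx_inj; rewrite trmx_mul A0_sym Qxs A0Q trmx0.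
have [K [r [K0 r0 KP]]] := projection_expansion QxQx A0Q QA0 trQ.
have [C C0 HC] := differentiable_lipschitz_near dHx.
have LHd := differentiable_mx_linear L dHx.
have [|dQ dQE] := @diff_littleo _ _ _ Q (L \o H) x LHd; last first.
  split; first exact: dQ.
  exact: etrans dQE (diff_mx_linear L dHx).
move=> e e0.
(* [r] admits the expansion, the quotient makes the remainder at most [e] times the distance, and
   [+ 1] covers [K = 0]. *)
pose s := Num.min r (e / (K * (m%:R * C) + 1)).
have KmC : 0 < K * (m%:R * C) + 1 by rewrite ltr_wpDl// !mulr_ge0// ltW.
have s0 : 0 < s by rewrite /s lt_min r0 divr_gt0.
have sm0 : 0 < s / m%:R by rewrite divr_gt0.
near=> y.
have [Hys projy] : (H y)^T = H y /\ is_orthoproj (eigenspace_col (H y) (lam y)) (Q y).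
  by near: y.
have [Qys QyQy] := orthoproj_sym_idem projy.
have Hy : `|H y - H x| <= C * `|y - x| by near: y.
have : scaled_mx_norm (Q y - Q x) <= s.
  rewrite /scaled_mx_norm mulrC -ler_pdivlMr//; near: y.
  exact: (cvgrPdistC_le _ _).1.
rewrite {1}/s le_min => /andP[Er Es].
have := KP (Q y) (H y - H x) (lam y - lam x) QyQy
  (resolvent_perturbation_left A0H projy)
  (resolvent_perturbation_right A0H projx projy Hxs Hys A0_sym)
  (trace_perturbation projx projy Hxs) Er.
have -> : A0 *m (H y - H x) *m Q x + Q x *m (H y - H x) *m A0 = (L \o H) y - (L \o H) x.
  by rewrite -linearB /= addrC.
move=> Ry; apply: le_trans (mx_norm_le_scaled _ m_gt0) _; apply: le_trans Ry _.
move: Es; rewrite ler_pdivlMr// => Es.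
have := scaled_mx_norm_ge0 (Q y - Q x); set E := scaled_mx_norm _ in Es * => E0.
rewrite /scaled_mx_norm.
have KE : 0 <= K * m%:R * E by rewrite !mulr_ge0.
apply: (@le_trans _ _ (K * m%:R * E * (C * `|y - x|))).
  by rewrite [leLHS](_ : _ = K * m%:R * E * `|H y - H x|) ?ler_wpM2l//; ring.
have := normr_ge0 (y - x); move: (`|y - x|) => w w0.
rewrite [leLHS](_ : _ = E * (K * (m%:R * C)) * w); last by ring.
by rewrite ler_wpM2r// (le_trans _ Es)// ler_wpM2l// lerDl.
Unshelve. all: by end_near. Qed.

End EigenprojectionDifferential.

Theorem theorem3p1 (R : realType) (n m : nat) (Omega : set 'rV[R]_n)
    (H : 'rV[R]_n -> 'M[R]_m) (lam : 'I_m -> 'rV[R]_n -> R)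
    (P : 'I_m -> 'rV[R]_n -> 'M[R]_m) (j : 'I_m)
    (Omega_domain : is_domain Omega)
    (H_sym : forall x, Omega x -> (H x)^T = H x)
    (H_C1 : C1_on Omega H)
    (lam_eig : forall x, Omega x -> sorted_eigenvalues (H x) (fun i => lam i x))
    (P_proj : forall (i : 'I_m) x, Omega x ->
       is_orthoproj (eigenspace_col (H x) (lam i x)) (P i x))
    (P_hyp : {within Omega, continuous (P j)} \/
       ((forall x, Omega x -> differentiable (lam j) x) /\
        (forall x y, Omega x -> Omega y -> \tr (P j x) = \tr (P j y)))) :
  let A := fun x => Amx (fun i => lam i x) (fun i => P i x) j in
  forall x, Omega x ->
    [/\ differentiable (P j) x,
        (forall q : 'cV[R]_m,
           nabla q (P j) x =
             P j x *m nabla (A x *m q) H x + A x *m nabla (P j x *m q) H x) &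
        (forall e : 'rV[R]_n,
           'D_e (P j) x =
             P j x *m 'D_e H x *m A x + A x *m 'D_e H x *m P j x)].
Proof.
move=> A x Ox; have [_ Oopen _] := Omega_domain; have [dH _] := H_C1.
have dHx := dH _ Ox; have Hs := H_sym _ Ox; have [_ charH] := lam_eig _ Ox.
have projx i := P_proj i _ Ox.
have near_Omega : \forall y \near x, Omega y by exact: open_nbhs_nbhs.
have Hproj : \forall y \near x, (H y)^T = H y /\
    is_orthoproj (eigenspace_col (H y) (lam j y)) (P j y).
  by apply: filterS near_Omega => y Oy; split; [exact: H_sym|exact: P_proj].
have AH : A x *m H x = lam j x *: A x - (1%:M - P j x).
  exact: mul_Amx_mx Hs charH projx j.
have As : (A x)^T = A x by exact: Amx_sym projx j.
have AP : A x *m P j x = 0 by exact: mul_Amx_eigenproj Hs projx j.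
have trP : 1 <= \tr (P j x) by exact: tr_eigenproj_ge1 Hs charH projx j.
(* Both alternatives reduce to continuity at [x]; in the first, openness of [Omega] turns relative
   continuity into continuity at the point. *)
have Pc : {for x, continuous (P j)}.
  case: P_hyp => [|[dlam trc]].
    by rewrite continuous_open_subspace// => /(_ x); apply; rewrite inE.
  apply: (cvg_eigenprojection AH trP Hproj).
  - exact: differentiable_continuous.
  - exact/differentiable_continuous/dlam.
  - by apply: filterS near_Omega => y Oy; exact: trc.
have [dP dPE] := diff_eigenprojection AH As AP trP Hproj dHx Pc.
have dPv v : 'd (P j) x v = P j x *m 'd H x v *m A x + A x *m 'd H x v *m P j x.
  exact: (f_equal (fun f : 'rV[R]_n -> 'M[R]_m => f v) dPE).
split; first exact: dP.
  (* The Jacobians are compared on each direction [xi^T], where [nablaE] expresses all three through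
     differentials. *)
  move=> q; apply: eq_mulmx_col => xi; rewrite -[xi]trmxK (nablaE _ _ dP) dPv.
  have := nablaE (A x *m q) xi^T dHx; have := nablaE (P j x *m q) xi^T dHx.
  move: (nabla (A x *m q) H x) (nabla (P j x *m q) H x) ('d H x xi^T) => N1 N2 B.
  by move=> N2E N1E; rewrite !mulmxDl -!mulmxA N1E N2E.
by move=> e; rewrite (deriveE _ dP) (deriveE _ dHx).
Qed.
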